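(* Let $d\geq 2$, $k\geq 1$ and $\mathbf{k}=(k,k,\dots,k)\in\mathbb{N}^{d+1}$. Then the automorphism group of the simplicial complex $T_{\mathbf{k}}$ is generated by (the automorphisms induced by) $T$, $R$ and $C_{d+1}$, and has cardinality $2(d+1)\det M_{\mathbf{k}}$.
   Context: Let $e_1,\dots,e_{d+1}$ be the standard basis of $\mathbb{R}^{d+1}$, $\widetilde w_i=e_i-\frac1{d+1}\sum_je_j$. $M_{\mathbf{k}}$ is the $(d+1)\times(d+1)$ integer matrix whose $i$-th row has entry $k_i+1$ in column $i$, entry $-k_{i+1}$ in column $i+1$ (indices cyclic mod $d+1$), zeros elsewhere; $\widetilde L_{\mathbf{k}}=\{\sum a_i\widetilde w_i: a=bM_{\mathbf{k}},\ b\in\mathbb{Z}^{d+1}\}$. $V=\{\mathbf{x}:\sum x_i=0\}$; $\Sigma_d$ is the simplicial complex on $V$ cut out by the affine hyperplanes $x_j-x_i=m$ ($i<j$, $m\in\mathbb{Z}$), with vertex set the lattice $\widetilde\Lambda_d=\mathbb{Z}$-span of the $\widetilde w_i$. $T_{\mathbf{k}}$ is the complex whose faces are the classes of faces of $\Sigma_d$ under translation by $\widetilde L_{\mathbf{k}}$ (a class contained in another if some representatives are). $T$ denotes the group of automorphisms of $T_{\mathbf{k}}$ induced by translations of $V$ by vectors of $\widetilde\Lambda_d$; $R$ is the automorphism induced by $\mathbf{x}\mapsto-\mathbf{x}$ (sending each $\widetilde w_i$ to $-\widetilde w_i$); $C_{d+1}$ is the cyclic group of automorphisms induced by the cyclic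 coordinate shift sending $\widetilde w_i$ to $\widetilde w_{i+1}$ (indices mod $d+1$). *)

(* Defs.v *)
From mathcomp Require Import all_boot all_order all_algebra.
From mathcomp Require Import boolp classical_sets functions cardinality reals.

Set Implicit Arguments.
Unset Strict Implicit.
Unset Printing Implicit Defensive.

Import Order.TTheory GRing.Theory Num.Theory.
Local Open Scope classical_set_scope.
Local Open Scope ring_scope.

Section Complexes.
Variables (R : realType) (d : nat).
Local Notation E := 'rV[R]_d.+1.

Definition wt (i : 'I_d.+1) : E :=
  delta_mx 0 i - (d.+1%:R)^-1 *: \sum_(j < d.+1) delta_mx 0 j.

Definition hyperplaneV : set E := [set x | \sum_(i < d.+1) x 0 i = 0].

Definition Lambda : set E :=
  [set x | exists a : 'rV[int]_d.+1, x = \sum_(i < d.+1) wt i *~ a 0 i].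

(* [ordS] is the cyclic successor on ['I_d.+1]. *)
Definition Mmx (k : 'I_d.+1 -> nat) : 'M[int]_d.+1 :=
  \matrix_(i, j) ((k i).+1%:Z *+ (j == i) - (k (ordS i))%:Z *+ (j == ordS i)).

Definition Llat (k : 'I_d.+1 -> nat) : set E :=
  [set x | exists b : 'rV[int]_d.+1,
     x = \sum_(i < d.+1) wt i *~ (b *m Mmx k) 0 i].

(* The closed face of the arrangement {x_j - x_i = m} whose relative interior
   contains x: the intersection of V with all the closed half-spaces that are
   bounded by a hyperplane of the arrangement and contain x. *)
Definition closed_face (x : E) : set E :=
  [set y | hyperplaneV y /\
    forall (i j : 'I_d.+1) (m : int), (i < j)%N ->
      (x 0 j - x 0 i <= m%:~R -> y 0 j - y 0 i <= m%:~R) /\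
      (m%:~R <= x 0 j - x 0 i -> m%:~R <= y 0 j - y 0 i)].

(* The (nonempty) faces of Sigma_d, as subsets of V. *)
Definition Sigma : set (set E) :=
  [set F | exists2 x, hyperplaneV x & F = closed_face x].

Definition translate (v : E) (F : set E) : set E := [set x + v | x in F].

Definition face_class (k : 'I_d.+1 -> nat) (F : set E) : set (set E) :=
  [set G | exists2 l, Llat k l & G = translate l F].

Definition Tk (k : 'I_d.+1 -> nat) : set (set (set E)) :=
  [set c | exists2 F, Sigma F & c = face_class k F].

Definition contained (k : 'I_d.+1 -> nat) (c c' : Tk k) : Prop :=
  exists F G, [/\ val c F, val c' G & F `<=` G].

Definition automorphism (k : 'I_d.+1 -> nat) : set (Tk k -> Tk k) :=
  [set f | bijective f /\
     forall c c', contained (f c) (f c') <-> contained c c'].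

(* The map f on the faces of T_k is induced by the map g: it sends the class
   of F to the class of g(F), for every face F of Sigma_d. *)
Definition induced (k : 'I_d.+1 -> nat) (g : E -> E) : set (Tk k -> Tk k) :=
  [set f | forall c F, val c F -> val (f c) (g @` F)].

Definition cyclic_shift (x : E) : E := \row_i x 0 (ord_pred i).

Definition Ttrans (k : 'I_d.+1 -> nat) : set (Tk k -> Tk k) :=
  [set f | exists2 v, Lambda v & induced (fun x => x + v) f].

Definition Rrefl (k : 'I_d.+1 -> nat) : set (Tk k -> Tk k) :=
  induced (fun x => - x).

Definition Ccyc (k : 'I_d.+1 -> nat) : set (Tk k -> Tk k) :=
  [set f | exists n, induced (iter n cyclic_shift) f].

End Complexes.

Definition subgroup (X : Type) (H : set (X -> X)) : Prop :=
  [/\ H id,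
      forall f g, H f -> H g -> H (f \o g) &
      forall f g, H f -> cancel f g -> cancel g f -> H g].

Definition generated (X : Type) (S : set (X -> X)) : set (X -> X) :=
  smallest (@subgroup X) S.

Arguments automorphism R {d} k.
Arguments Ttrans R {d} k.
Arguments Rrefl R {d} k.
Arguments Ccyc R {d} k.

(* Main.v *)
(* Sending the class of w_i to (k+1)^i k^(d-i) identifies the vertex group
   Lambda / L of T_k with Z/N, where N = (k+1)^(d+1) - k^(d+1) = det M; passing
   from w_i to w_(i+1) is multiplication by q = (k+1)/k.  The sums w_S over proper
   subsets S of the indices stay pairwise distinct in Z/N, so around a vertex x
   the complex looks like Sigma_d: the neighbours are the x + w_S, and x, x + w_S,
   x + w_T lie in a common face iff S and T are comparable.  An automorphism f thus
   induces at x an automorphism of the comparability graph of a Boolean lattice,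
   that is a permutation s of the indices, possibly composed with complementation;
   since w of a complement is the opposite of w, f(x + w_S) = f(x) +- w_(s S).
   Comparing x with x + w_0 shows that the sign and s do not depend on x, and w_0
   generates Z/N, so f(x) = f(0) +- q^(s 0) x on vertices.  These maps are the
   composites of the given generators, they are pairwise distinct, and an
   automorphism is determined by its vertex map because faces are determined by
   their vertices. *)

From mathcomp Require Import all_boot all_order all_algebra all_fingroup zify lra.
Require Import Defs.
Set Implicit Arguments.
Unset Strict Implicit.
Unset Printing Implicit Defensive.
Import Order.TTheory GRing.Theory Num.Theory.

(** * Automorphisms of the comparability graph of a Boolean lattice *)

Section ComparabilityAutomorphisms.
Variable n : nat.
Hypothesis n_ge3 : (2 < n)%N.
Implicit Types (S T : {set 'I_n}) (f : {set 'I_n} -> {set 'I_n}).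

Definition comparable S T := (S \subset T) || (T \subset S).

(** The empty and the full set are comparable to every set, so comparability alone could exchange
    them; both are fixed by convention. *)
Definition comparability_aut f :=
  [/\ injective f, f set0 = set0, f setT = setT &
      forall S T, comparable (f S) (f T) = comparable S T].

Lemma set1_neqT (i : 'I_n) : [set i] != setT.
Proof.
by apply/eqP => /(congr1 (fun X : {set _} => #|X|)); rewrite cards1 cardsT card_ord; lia.
Qed.

Lemma comparable0 S : comparable set0 S.
Proof. by rewrite /comparable sub0set. Qed.

Lemma comparable1 i S : S != set0 -> #|S| != 1%N ->
  comparable [set i] S = (i \in S).
Proof.
move=> S0 S1; rewrite /comparable sub1set subset1 (negPf S0) orbF.
have -> : (S == [set i]) = false by apply: contraNF S1 => /eqP->; rewrite cards1.
by rewrite orbF.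
Qed.

Lemma comparableC S T : comparable (~: S) (~: T) = comparable S T.
Proof. by rewrite /comparable !setCS orbC. Qed.

(** The supersets of [S] are the complements of the subsets of [~: S]; [S] itself is counted both as
    a subset and as a superset, hence the successor. *)
Lemma card_comparable S :
  (#|[set T | comparable S T]|.+1 = 2 ^ #|S| + 2 ^ (n - #|S|))%N.
Proof.
have -> : [set T | comparable S T] = powerset S :|: (@setC _) @: powerset (~: S).
  apply/setP=> T; rewrite !inE /comparable orbC; congr (_ || _).
  apply/idP/imsetP => [ST|[U]].
    by exists (~: T); rewrite ?setCK // powersetE setCS.
  by rewrite powersetE => US ->; rewrite -setCS setCK.
have := cardsUI (powerset S) ((@setC _) @: powerset (~: S)).
have -> : powerset S :&: (@setC _) @: powerset (~: S) = [set S].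
  apply/setP=> T; rewrite !inE; apply/andP/eqP => [[TS /imsetP[U]]|->].
    rewrite powersetE => US TU; apply/eqP; rewrite eqEsubset TS /=.
    by rewrite TU -setCS setCK.
  by split=> //; apply/imsetP; exists (~: S); rewrite ?setCK // powersetE.
rewrite cards1 addn1 card_imset; last exact: setC_inj.
have <- : #|~: S| = (n - #|S|)%N by rewrite cardsCs setCK card_ord.
by rewrite !card_powerset => ->.
Qed.

(* f preserves the degree 2^s + 2^(n-s) of a set of size s, which is maximal
   exactly for s = 1 and s = n - 1. *)
Lemma comparability_aut_extreme f i : comparability_aut f ->
  #|f [set i]| = 1%N \/ #|f [set i]| = n.-1.
Proof.
move=> [finj f0 fT fcmp].
have deg : #|[set T | comparable (f [set i]) T]| =
           #|[set T | comparable [set i] T]|.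
  rewrite -[RHS](card_imset _ finj); apply: eq_card => T; rewrite inE.
  have [g fK gK] := injF_bij finj.
  by rewrite -(gK T) fcmp mem_imset // inE.
have S0 : (0 < #|f [set i]|)%N.
  rewrite card_gt0 -f0; apply/eqP => /finj /setP /(_ i).
  by rewrite !inE eqxx.
have ST : (#|f [set i]| < n)%N.
  rewrite -[n in (_ < n)%N]card_ord -cardsT proper_card //.
  rewrite properT -fT; apply/eqP => /finj e.
  by have := cards1 i; rewrite e cardsT card_ord; lia.
move/(congr1 succn): deg; rewrite !card_comparable cards1.
set s := #|_| in S0 ST * => deg.
have [->|s1] := eqVneq s 1%N; first by left.
have [->|sn] := eqVneq s n.-1; first by right.
exfalso.
have h m : (2 <= m)%N -> (4 <= 2 ^ m)%N by move=> m2; exact: (@leq_pexp2l 2 2 m).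
have /h h1 : (2 <= s)%N by lia.
have /h h2 : (2 <= n - s)%N by lia.
(* With $A = 2^s$ and $B = 2^{n-s}$, equal degrees mean $A + B = 2 + AB/2$, that is $(A-2)(B-2) =
   0$, impossible for $A, B \ge 4$. *)
have e : (2 * 2 ^ (n - 1) = 2 ^ s * 2 ^ (n - s))%N.
  by rewrite -expnD -expnS; congr (_ ^ _)%N; lia.
nia.
Qed.

(** A set with at least two elements is recovered from the singletons comparable to it, so [f] is
    determined by its action on singletons. *)
Lemma comparability_aut_perm f : comparability_aut f ->
  (forall i, #|f [set i]| = 1%N) ->
  exists s : {perm 'I_n}, forall S, f S = [set s x | x in S].
Proof.
move=> [finj f0 fT fcmp] f1.
have /fin_all_exists [t ft] i : exists a, f [set i] = [set a].
  by apply/cards1P/eqP/f1.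
have tinj : injective t.
  by move=> i j e; apply: set1_inj; apply: finj; rewrite !ft e.
exists (perm tinj) => S.
have imE i : (perm tinj i \in [set perm tinj x | x in S]) = (i \in S).
  by rewrite mem_imset //; apply: perm_inj.
apply/setP=> x; rewrite -[x](permKV (perm tinj)); set i := ((perm tinj)^-1)%g x.
rewrite imE permE.
have [->|S0] := eqVneq S set0; first by rewrite f0 !inE.
have [/eqP/cards1P[l ->]|S1] := eqVneq #|S| 1%N.
  by rewrite ft !inE (inj_eq tinj).
rewrite -(comparable1 i S0 S1) -fcmp ft comparable1 //.
  by rewrite -f0 (inj_eq finj).
(* Every singleton is already the image of a singleton, so by injectivity [f S] is not one. *)
apply: contra S1 => /cards1P[y fS].
have [l ly] : exists l, t l = y by exists ((perm tinj)^-1 y)%g; rewrite -[t _](permE tinj) permKV.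
by have := finj S [set l]; rewrite ft ly fS => -> //; rewrite cards1.
Qed.

(** Singletons go all to singletons or all to complements of singletons. In the second case,
    composing with complementation reduces to the first. *)
Lemma comparability_autP f : comparability_aut f ->
  exists s : {perm 'I_n}, (forall S, f S = [set s x | x in S]) \/
    (forall S, S != set0 -> S != setT -> f S = ~: [set s x | x in S]).
Proof.
move=> faut; have [finj f0 fT fcmp] := faut.
have ext i := comparability_aut_extreme i faut.
have cE (X : {set 'I_n}) : #|X| = n.-1 -> exists a, X = ~: [set a].
  move=> hX; have /cards1P[a ha] : #|~: X| == 1%N.
    by rewrite cardsCs setCK card_ord hX; lia.
  by exists a; rewrite -ha setCK.
have cmp1C (a b : 'I_n) : comparable [set a] (~: [set b]) = (a != b).
  have cb : #|~: [set b]| = n.-1 by rewrite cardsC1 card_ord.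
  rewrite comparable1 ?in_setC1 //; first by rewrite -card_gt0 cb; lia.
  by rewrite cb; lia.
have cmp11 (i j : 'I_n) : comparable [set i] [set j] = (i == j).
  by rewrite /comparable !sub1set !in_set1 eq_sym orbb.
have mixed i j a b : f [set i] = [set a] -> f [set j] = ~: [set b] -> a = b.
  move=> fi fj; have := fcmp [set i] [set j]; rewrite fi fj cmp1C cmp11.
  case: (eqVneq i j) => [ij|_ /negbT/negPn/eqP //].
  move: fj; rewrite -ij fi => /(congr1 (fun X : {set _} => #|X|)).
  by rewrite cards1 cardsC1 card_ord; lia.
have [f1|] := boolP [forall i, #|f [set i]| == 1%N].
  have [s fs] := comparability_aut_perm faut (fun i => eqP (forallP f1 i)).
  by exists s; left.
rewrite negb_forall => /existsP[j fj].
have {}fj : #|f [set j]| = n.-1.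
  by have [e|//] := ext j; rewrite e in fj.
have {}fn i : #|f [set i]| = n.-1.
  have [fi|//] := ext i.
  have /eqP/cards1P[a fia] := fi; have [b fjb] := cE _ fj.
  (* Whichever form the image of a third singleton has, [mixed] makes it coincide with [f [set i]]
     or [f [set j]]. *)
  have [l] : exists l, l \in ~: [set i; j].
    apply/set0Pn; rewrite -card_gt0 cardsCs setCK card_ord cards2; lia.
  rewrite !inE negb_or => /andP[li lj].
  have [/eqP/cards1P[c flc]|/cE[c flc]] := ext l.
    have := mixed _ _ _ _ flc fjb; rewrite -(mixed _ _ _ _ fia fjb) => ca.
    by move: flc li; rewrite ca -fia => /finj/set1_inj ->; rewrite eqxx.
  have := mixed _ _ _ _ fia flc; rewrite (mixed _ _ _ _ fia fjb) => bc.
  by move: flc lj; rewrite -bc -fjb => /finj/set1_inj ->; rewrite eqxx.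
(* Complementation would exchange the empty and the full set, hence the exception. *)
pose g S := if (S == set0) || (S == setT) then S else ~: f S.
have gE S : S != set0 -> S != setT -> g S = ~: f S.
  by rewrite /g => /negPf-> /negPf->.
have setT0 : [set: 'I_n] != set0.
  by rewrite -card_gt0 cardsT card_ord; lia.
have f_set0 S : (f S == set0) = (S == set0) by rewrite -{1}f0 (inj_eq finj).
have f_setT S : (f S == setT) = (S == setT) by rewrite -{1}fT (inj_eq finj).
have g_set0 S : (g S == set0) = (S == set0).
  rewrite /g; case: (eqVneq S set0) => [->|S0]; first by rewrite eqxx.
  case: (eqVneq S setT) => [->|ST]; first by rewrite (negPf setT0).
  by rewrite -(inj_eq (@setC_inj _)) setCK setC0 f_setT (negPf ST).
have g_setT S : (g S == setT) = (S == setT).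
  rewrite /g; case: (eqVneq S set0) => [->|S0] //.
  case: (eqVneq S setT) => [->|ST]; first by rewrite eqxx.
  by rewrite -(inj_eq (@setC_inj _)) setCK setCT f_set0 (negPf S0).
have gaut : comparability_aut g.
  have g0 : g set0 = set0 by apply/eqP; rewrite g_set0.
  have gT : g setT = setT by apply/eqP; rewrite g_setT.
  split=> // S T.
    have [->|S0] := eqVneq S set0.
      by move/esym/eqP; rewrite g0 g_set0 => /eqP.
    have [->|ST] := eqVneq S setT.
      by move/esym/eqP; rewrite gT g_setT => /eqP.
    move=> e; have T0 : T != set0 by rewrite -g_set0 -e g_set0.
    have TT : T != setT by rewrite -g_setT -e g_setT.
    by move: e; rewrite !gE // => /setC_inj/finj.
  have cT (X : {set 'I_n}) : comparable setT X by rewrite /comparable subsetT orbT.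
  have sym (X Y : {set 'I_n}) : comparable X Y = comparable Y X by rewrite /comparable orbC.
  have [->|S0] := eqVneq S set0; first by rewrite g0 !comparable0.
  have [->|ST] := eqVneq S setT; first by rewrite gT !cT.
  have [->|T0] := eqVneq T set0; first by rewrite g0 !(sym _ set0) !comparable0.
  have [->|TT] := eqVneq T setT; first by rewrite gT !(sym _ setT) !cT.
  by rewrite !gE // comparableC.
have g1 i : #|g [set i]| = 1%N.
  have s1 : [set i] != set0 by rewrite -card_gt0 cards1.
  by rewrite gE ?set1_neqT // cardsCs setCK fn card_ord; lia.
have [s gs] := comparability_aut_perm gaut g1.
by exists s; right=> S S0 ST; rewrite -gs gE // setCK.
Qed.
End ComparabilityAutomorphisms.

Local Open Scope ring_scope.

(** * The vertex group Z/N *)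

(* weight d k i is the image of w_i in Z/N, for N = modulus d k. *)
Definition modulus (d k : nat) : nat := (k.+1 ^ d.+1 - k ^ d.+1)%N.
Definition weight (d k i : nat) : nat := (k.+1 ^ i * k ^ (d - i))%N.

Section Weights.
Variables d k : nat.
Hypothesis k_gt0 : (0 < k)%N.
Local Notation N := (modulus d k).
Local Notation c := (weight d k).

Lemma weight_gt0 i : (0 < c i)%N.
Proof. by rewrite muln_gt0 !expn_gt0 k_gt0. Qed.

Lemma weightS i : (i < d)%N -> (k * c i.+1 = k.+1 * c i)%N.
Proof.
move=> id; rewrite /weight (_ : d - i = (d - i.+1).+1)%N; last lia.
rewrite !expnS; lia.
Qed.

Lemma sum_weight : (\sum_(i < d.+1) c i = N)%N.
Proof.
rewrite /modulus subn_exp subSnn mul1n (reindex_inj rev_ord_inj) /=.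
by apply: eq_bigr => i _; rewrite /weight subSS subKn // -ltnS.
Qed.

Lemma modulus_gt1 : (0 < d)%N -> (1 < N)%N.
Proof.
move=> d0; rewrite -sum_weight.
apply: (@leq_trans (\sum_(i < d.+1) 1)%N); first by rewrite sum1_card card_ord.
by apply: leq_sum => i _; apply: weight_gt0.
Qed.

(** Adding $k^{d+1}$ to $N$ gives $(k+1)^{d+1}$, which is coprime to $k$. *)
Lemma coprime_modulus : coprime N k.
Proof.
rewrite coprime_sym /coprime -(gcdnMDl (k ^ d)) -expnSr subnKC ?leq_exp2r //.
by rewrite -/(coprime _ _) coprimeXr // coprimenS.
Qed.

(* Modulo k+1 only the term i = 0 survives, and it determines the digit. *)
Lemma digits_inj m (u v : nat -> bool) :
  (\sum_(i < m) u i * weight m.-1 k i = \sum_(i < m) v i * weight m.-1 k i)%N ->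
  forall i, (i < m)%N -> u i = v i.
Proof.
elim: m u v => [//|m IH] u v; rewrite !big_ord_recl /=.
have shift (w : nat -> bool) : (\sum_(i < m) w (bump 0 i) * weight m k (bump 0 i) =
    k.+1 * \sum_(i < m) w i.+1 * weight m.-1 k i)%N.
  rewrite big_distrr /=; apply: eq_bigr => i _; rewrite /bump /= add1n /weight.
  rewrite expnS (_ : m - i.+1 = m.-1 - i)%N; last lia.
  lia.
rewrite !shift {1 3}/weight subn0 expn0 !mul1n => e.
have ndvd : ~~ (k.+1 %| k ^ m)%N.
  apply/negP => /gcdn_idPl g.
  have /eqP : coprime k.+1 (k ^ m) by rewrite coprimeXr // coprimeSn.
  by rewrite g; lia.
have e0 : u 0%N = v 0%N.
  have dvd A B : (k ^ m + k.+1 * A = k.+1 * B)%N -> (k.+1 %| k ^ m)%N.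
    by move=> h; rewrite -(@dvdn_addl (k.+1 * A)) ?h ?dvdn_mulr.
  case: (u 0%N) (v 0%N) e => -[] //; rewrite mul1n mul0n add0n => e; case/negP: ndvd.
    exact: dvd e.
  by apply: dvd; symmetry; exact: e.
move: e; rewrite e0 => /addnI /eqP; rewrite eqn_mul2l /= => /eqP e [|i] //.
by apply: (IH (fun i => u i.+1) (fun i => v i.+1)).
Qed.

(* Solves a = b M one coordinate at a time; s and t are the values of b before the
   first and after the last step, so s = t is the cyclic case. *)
Lemma telescope_weights m (a : nat -> int) (s t : int) :
  \sum_(i < m) a i * (weight m.-1 k i)%:Z = k.+1%:Z ^+ m * t - k%:Z ^+ m * s ->
  exists b : nat -> int, [/\ b 0%N = s, b m = t &
    forall i, (i < m)%N -> a i = k.+1%:Z * b i.+1 - k%:Z * b i].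
Proof.
elim: m a s => [|m IH] a s.
  rewrite big_ord0 !expr0 !mul1r => e; exists (fun=> s); split=> //.
  by apply/eqP; rewrite eq_sym -subr_eq0 -e.
rewrite big_ord_recl /=.
have -> : \sum_(i < m) a (bump 0 i) * (weight m k (bump 0 i))%:Z =
    k.+1%:Z * \sum_(i < m) a i.+1 * (weight m.-1 k i)%:Z.
  rewrite big_distrr /=; apply: eq_bigr => i _; rewrite /bump /= add1n /weight.
  rewrite expnS (_ : m - i.+1 = m.-1 - i)%N; last lia.
  by rewrite -mulnA PoszM mulrCA.
rewrite {1}/weight subn0 expn0 mul1n -natz natrX natz.
set X := \sum_(i < m) _ => e.
(* As $k^m$ is coprime to $k+1$, it follows that $k+1$ divides $a_0 + ks$; the quotient is the next
   value of [b]. *)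
have e1 : k%:Z ^+ m * (a 0%N + k%:Z * s) = k.+1%:Z * (k.+1%:Z ^+ m * t - X).
  by move: e; rewrite !exprS => e; lia.
have /dvdzP[b1 hb1] : (k.+1%:Z %| a 0%N + k%:Z * s)%Z.
  rewrite -(@Gauss_dvdzr _ (k%:Z ^+ m)) ?e1 ?dvdz_mulr //.
  by rewrite coprimezXr // coprimezE coprimeSn.
have [b [b0 bt hb]] : exists b : nat -> int, [/\ b 0%N = b1, b m = t &
    forall i, (i < m)%N -> a i.+1 = k.+1%:Z * b i.+1 - k%:Z * b i].
  apply: IH; rewrite -/X; apply: (@mulfI _ k.+1%:Z) => //.
  by move: e1; rewrite hb1 => e1; lia.
exists (fun i => if i is j.+1 then b j else s); split=> // -[_|i im] /=; last exact: hb.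
by rewrite b0; lia.
Qed.
End Weights.

(** * Residues of lattice vectors modulo N *)

Section Residues.
Variables d k : nat.
Hypotheses (d_gt0 : (0 < d)%N) (k_gt0 : (0 < k)%N).
Local Notation N := (modulus d k).
Local Notation c := (weight d k).
Local Notation M := (Mmx (fun _ : 'I_d.+1 => k)).
Local Notation n := d.+1.
Implicit Types (S T : {set 'I_n}) (a b : 'rV[int]_n).

(** [omega S] is the residue of $w_S$; [phi a] below is the residue of $\sum_i a_i w_i$, and [ratio]
    is the multiplier $q$. *)
Definition omega S : 'Z_N := \sum_(i in S) (c i)%:R.
Definition phi a : 'Z_N := \sum_i (a 0 i)%:~R * (c i)%:R.
Definition ratio : 'Z_N := k.+1%:R / k%:R.
Definition row_of_set S : 'rV[int]_n := \row_i (i \in S)%:Z.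
Definition row_shift a : 'rV[int]_n := \row_i a 0 (ord_pred i).

Let N_gt1 : (1 < N)%N. Proof. exact: modulus_gt1. Qed.

Lemma natr_modulus : N%:R = 0 :> 'Z_N. Proof. exact: pchar_Zp. Qed.

Lemma k_unit : (k%:R : 'Z_N) \is a GRing.unit.
Proof. by rewrite unitZpE // coprime_modulus. Qed.

Lemma weight0_unit : ((c 0)%:R : 'Z_N) \is a GRing.unit.
Proof. by rewrite /weight mul1n natrX unitrX ?k_unit. Qed.

Lemma natr_eq0_modulus x : (x%:R == 0 :> 'Z_N) = (N %| x)%N.
Proof. by rewrite -(inj_eq val_inj) /= val_Zp_nat. Qed.

Lemma intr_eq0_modulus (z : int) : z%:~R = 0 :> 'Z_N -> (N %| z)%Z.
Proof.
case: z => x /=; first by move=> /eqP; rewrite natr_eq0_modulus dvdzE.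
by move=> /eqP; rewrite NegzE mulrNz oppr_eq0 natr_eq0_modulus dvdzE.
Qed.

(** Before the last index this is [weightS]; the wrap-around from $d$ to $0$ amounts to $(k+1)^{d+1}
    = k^{d+1}$ in Z/N. *)
Lemma ratio_weight (i : 'I_n) : (c (ordS i))%:R = ratio * (c i)%:R :> 'Z_N.
Proof.
apply: (mulrI k_unit); rewrite /ratio mulrA mulrCA divrr ?k_unit // mulr1 -!natrM.
rewrite /=; have [id|] := ltnP i.+1 d.+1; first by rewrite modn_small // weightS.
move=> di; have {di} -> : i = d :> nat by have := ltn_ord i; lia.
rewrite modnn /weight subnn subn0 mul1n muln1 -!expnS.
have -> : (k.+1 ^ n = N + k ^ n)%N by rewrite subnK // leq_exp2r.
by rewrite natrD natr_modulus add0r.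
Qed.

Lemma weight_ratioX (i : 'I_n) : (c i)%:R = ratio ^+ i * (c 0)%:R :> 'Z_N.
Proof.
case: i => i; elim: i => [|i IH] hi; first by rewrite expr0 mul1r.
have := ratio_weight (Ordinal (ltnW hi)); rewrite /= modn_small // => ->.
by rewrite (IH (ltnW hi)) exprS mulrA.
Qed.

Lemma omega0 : omega set0 = 0. Proof. by rewrite /omega big_set0. Qed.

Lemma omega1 i : omega [set i] = (c i)%:R.
Proof. by rewrite /omega big_set1. Qed.

Lemma omegaT : omega setT = 0.
Proof.
rewrite /omega -natr_sum (eq_bigl xpredT) => [|i]; last by rewrite inE.
by rewrite sum_weight natr_modulus.
Qed.

Lemma omegaU S T : [disjoint S & T] -> omega (S :|: T) = omega S + omega T.
Proof. by move=> dST; rewrite /omega -bigU //=; apply: eq_bigl => i; rewrite !inE. Qed.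

Lemma omegaC S : omega (~: S) = - omega S.
Proof.
apply/eqP; rewrite -addr_eq0 addrC -omegaU ?setUCr ?omegaT //.
by rewrite -setI_eq0 setICr.
Qed.

(** The weights over a proper subset sum to less than $N$, so equality modulo $N$ is equality of
    integers, and [digits_inj] applies. *)
Lemma omega_inj S T : S != setT -> T != setT -> omega S = omega T -> S = T.
Proof.
move=> ST TT; rewrite /omega -!natr_sum.
have small (X : {set 'I_n}) : X != setT -> (\sum_(i in X) c i < N)%N.
  rewrite -properT => /properP[_ [i _ iX]].
  rewrite -(sum_weight d k) [in ltnRHS](bigID (mem X)) /= -[ltnLHS]addn0 ltn_add2l.
  by rewrite (bigD1 i) /= ?iX // addn_gt0 weight_gt0.
move/(congr1 (fun z : 'Z_N => z : nat)); rewrite !val_Zp_nat // !modn_small ?small // => e.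
pose u (X : {set 'I_n}) i := if insub i is Some j then j \in X else false.
have uE (X : {set 'I_n}) (j : 'I_n) : u X j = (j \in X) by rewrite /u valK.
have sumE (X : {set 'I_n}) : (\sum_(i in X) c i = \sum_(i < n) u X i * c i)%N.
  by rewrite big_mkcond; apply: eq_bigr => i _; rewrite uE; case: ifP; rewrite ?mul1n.
apply/setP=> j; rewrite -!uE; move: e; rewrite !sumE => /digits_inj; exact.
Qed.

Lemma phiD a b : phi (a + b) = phi a + phi b.
Proof. by rewrite /phi -big_split; apply: eq_bigr => i _; rewrite mxE rmorphD mulrDl. Qed.

Lemma phiN a : phi (- a) = - phi a.
Proof. by rewrite /phi -sumrN; apply: eq_bigr => i _; rewrite mxE rmorphN mulNr. Qed.

Lemma phiB a b : phi (a - b) = phi a - phi b.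
Proof. by rewrite phiD phiN. Qed.

Lemma phi_row_of_set S : phi (row_of_set S) = omega S.
Proof.
rewrite /phi /omega [RHS]big_mkcond; apply: eq_bigr => i _; rewrite mxE.
by case: ifP; rewrite ?mul1r ?mul0r.
Qed.

(** The $w_i$ sum to zero, so a lattice point determines its coefficients only up to a constant row.
    Such a row has residue zero because the weights sum to $N$. *)
Lemma phi_eq a b : (forall i j, a 0 j - a 0 i = b 0 j - b 0 i) -> phi a = phi b.
Proof.
move=> h; have -> : a = b + \row_i (a 0 0 - b 0 0).
  by apply/rowP=> i; rewrite !mxE addrCA -(h 0 i) addrC subrK.
rewrite phiD [phi (\row_i _)](_ : _ = (a 0 0 - b 0 0)%:~R * omega setT).
  by rewrite omegaT mulr0 addr0.
rewrite /phi /omega big_distrr /= [RHS](eq_bigl xpredT) => [|i]; last by rewrite inE.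
by apply: eq_bigr => i _; rewrite mxE.
Qed.

Lemma phi_shift a : phi (row_shift a) = ratio * phi a.
Proof.
rewrite /phi big_distrr (reindex_inj (can_inj (@ordSK n))) /=.
by apply: eq_bigr => i _; rewrite mxE ordSK ratio_weight mulrCA.
Qed.

(** The weight $c_0 = k^d$ is a unit, so the multiples of $w_0$ already reach every residue. *)
Lemma phi_surj (z : 'Z_N) : exists a, phi a = z.
Proof.
have [v <-] : exists v : 'Z_N, v * (c 0)%:R = z.
  by exists (z / (c 0)%:R); rewrite divrK ?weight0_unit.
exists ((v : nat)%:Z *: row_of_set [set ord0]).
rewrite /phi (bigD1 ord0) //= big1 ?addr0 => [|i i0].
  by rewrite !mxE inE eqxx mulr1 -pmulrn natr_Zp.
by rewrite !mxE inE (negPf i0) mulr0 mul0r.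
Qed.

Lemma mulmx_Mmx (b : 'rV[int]_n) j :
  (b *m M) 0 j = k.+1%:Z * b 0 j - k%:Z * b 0 (ord_pred j).
Proof.
rewrite mxE; under eq_bigr do rewrite mxE mulrBr.
rewrite sumrB; congr (_ - _).
  rewrite (bigD1 j) //= eqxx big1 ?addr0 => [|i ij]; first by rewrite mulr1n mulrC.
  by rewrite eq_sym (negPf ij) mulr0n mulr0.
rewrite (bigD1 (ord_pred j)) //= ord_predK eqxx big1 ?addr0 => [|i ij].
  by rewrite mulr1n mulrC.
have -> : (j == ordS i) = false by apply: contraNF ij => /eqP->; rewrite ordSK.
by rewrite mulr0n mulr0.
Qed.

Lemma phi_Mmx b : phi (b *m M) = 0.
Proof.
have -> : b *m M = b *+ k.+1 - row_shift b *+ k.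
  apply/rowP => j; rewrite mulmx_Mmx !(mxE, summxE, mulmxnE).
  by rewrite -[k.+1%:Z]natz -[k%:Z]natz !mulr_natl.
have phiMn m a : phi (a *+ m) = m%:R * phi a.
  elim: m => [|m IH]; first by rewrite mulr0n mul0r -(subrr a) phiB subrr.
  by rewrite mulrS phiD IH -[m.+1%:R]natr1 mulrDl mul1r addrC.
by rewrite phiB !phiMn phi_shift mulrA [k%:R * _]mulrC /ratio divrK ?k_unit ?subrr.
Qed.

(** The integer sum $\sum_i a_i c_i$ is some $Nt = (k+1)^n t - k^n t$, so [telescope_weights] yields
    a sequence from $t$ back to $t$, which closes up cyclically. *)
Lemma phi_ker a : phi a = 0 -> exists b, a = b *m M.
Proof.
rewrite /phi => h; pose s := \sum_(i < n) a 0 i * (c i)%:Z.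
have /intr_eq0_modulus/dvdzP[t st] : s%:~R = 0 :> 'Z_N.
  by rewrite -h /s rmorph_sum; apply: eq_bigr => i _; rewrite rmorphM.
have [|b [b0 bn hb]] := @telescope_weights k k_gt0 n (fun i => a 0 (inord i)) t t.
  rewrite (eq_bigr (fun i : 'I_n => a 0 i * (c i)%:Z)) => [|i _]; last by rewrite inord_val.
  rewrite -/s st /modulus -mulrBl mulrC; congr (_ * _).
  by rewrite -subzn ?leq_exp2r // -!natz !natrX !natz.
(* Indices move by one because [b 0] is the value before the first step; at $j = 0$ the cyclic
   predecessor is the final value, equal to [b 0]. *)
exists (\row_i b i.+1); apply/rowP => j; rewrite mulmx_Mmx !mxE.
have := hb j (ltn_ord j); rewrite inord_val => ->; congr (_ - _ * _).
case: j => -[|j] hj /=; first by rewrite modn_small // b0 bn.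
by rewrite modnDr modn_small // ltnW.
Qed.
End Residues.

(* Multiplying M on the right by the lower triangular matrix whose first column is
   u clears the corner entry -k. *)
Lemma det_Mmx (d k : nat) : (0 < d)%N ->
  \det (Mmx (fun _ : 'I_d.+1 => k)) = (modulus d k)%:Z.
Proof.
move=> d_gt0; set M := Mmx _.
(* Chosen so that $(k+1)u_i = k u_{i+1}$ cyclically for $i \ge 1$: the first column of $MU$ vanishes
   below its top entry $(k+1)u_0 - k u_1 = N$. *)
pose u (i : nat) : nat := if i is j.+1 then (k.+1 ^ j * k ^ (d - j))%N else (k.+1 ^ d)%N.
pose U : 'M[int]_d.+1 := \matrix_(i, j) if j == ord0 then (u i)%:Z else (i == j)%:Z.
have detU : \det U = (k.+1 ^ d)%N.
  rewrite det_trig; last first.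
    apply/is_trig_mxP => i j ij; rewrite mxE -!val_eqE /=.
    by rewrite gtn_eqF ?(leq_ltn_trans _ ij) // ltn_eqF.
  rewrite big_ord_recl big1 ?mulr1 ?mxE ?eqxx // => i _.
  by rewrite mxE /= eqxx.
have ME (i j : 'I_d.+1) : M i j = k.+1%:Z *+ (j == i) - k%:Z *+ (j == ordS i).
  by rewrite mxE.
have MU (i j : 'I_d.+1) : (M *m U) i j =
    if j == ord0 then (modulus d k)%:Z *+ (i == ord0) else M i j.
  have rowsum (x : 'I_d.+1 -> int) :
      \sum_l M i l * x l = k.+1%:Z * x i - k%:Z * x (ordS i).
    under eq_bigr do rewrite ME mulrBl.
    rewrite sumrB; congr (_ - _).
      by rewrite (bigD1 i) //= eqxx mulr1n big1 ?addr0 // => l /negPf->; rewrite mul0r.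
    by rewrite (bigD1 (ordS i)) //= eqxx mulr1n big1 ?addr0 // => l /negPf->; rewrite mul0r.
  rewrite mxE; under eq_bigr do rewrite [U _ _]mxE.
  have [j0|j0] := eqVneq j ord0; last first.
    by rewrite (bigD1 j) //= eqxx mulr1 big1 ?addr0 // => l /negPf->; rewrite mulr0.
  rewrite (rowsum (fun l => (u l)%:Z)) -!PoszM /=.
  case: i {rowsum} => -[|i] hi /=.
    rewrite modn_small //= mul1n subn0 -!expnS /modulus mulr1n subzn //.
    by rewrite leq_exp2r.
  rewrite mulr0n; apply/eqP; rewrite subr_eq0; apply/eqP; congr Posz.
  have [id|di] := ltnP i.+2 d.+1.
    rewrite modn_small //= (_ : d - i = (d - i.+1).+1)%N; last lia.
    by rewrite !expnS; lia.
  have dE : d = i.+1 by lia.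
  rewrite (_ : i.+2 %% d.+1 = 0)%N; last by rewrite dE modnn.
  by rewrite /u dE subSnn !expnS; lia.
have := det_mulmx M U; rewrite detU -det_tr det_trig; last first.
  apply/is_trig_mxP => i j ij; rewrite mxE MU.
  case: eqP => [i0|i0].
    by rewrite -val_eqE /= gtn_eqF // (leq_ltn_trans _ ij).
  rewrite ME -!val_eqE /= ltn_eqF // mulr0n sub0r.
  have [jd|dj] := ltnP j.+1 d.+1.
    by rewrite modn_small // ltn_eqF ?mulr0n ?oppr0 // ltnW.
  have -> : nat_of_ord j = d by have := ltn_ord j; lia.
  by rewrite modnn; case: eqP => [i1|]; rewrite ?mulr0n ?oppr0 //; case: i0; apply: val_inj.
rewrite big_ord_recl mxE MU eqxx mulr1n.
have -> : \prod_(i < d) (M *m U)^T (lift ord0 i) (lift ord0 i) = (k.+1 ^ d)%N :> int.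
  under eq_bigr => i _.
    rewrite mxE MU /= ME eqxx mulr1n -val_eqE /=.
    rewrite (_ : (_ == _) = false) ?mulr0n ?subr0; last first.
      rewrite /bump /= add1n; have [jd|dj] := ltnP i.+2 d.+1.
        by rewrite modn_small // ltn_eqF.
      have -> : nat_of_ord i = d.-1 by have := ltn_ord i; lia.
      by rewrite prednK // modnn gtn_eqF.
    over.
  by rewrite prodr_const card_ord -!natz natrX.
have X0 : (k.+1 ^ d)%N%:Z != 0 by rewrite -natz pnatr_eq0 expn_eq0.
by move/(mulIf X0).
Qed.

(** * Rigidity of the vertex map *)

Section Rigidity.
Variables d k : nat.
Hypotheses (d_ge2 : (1 < d)%N) (k_gt0 : (0 < k)%N).
Local Notation N := (modulus d k).
Local Notation n := d.+1.
Local Notation om := (@omega d k).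
Implicit Types (S T : {set 'I_n}) (x y z : 'Z_N).

Let d_gt0 : (0 < d)%N. Proof. exact: ltnW. Qed.

Let n_ge3 : (2 < n)%N. Proof. exact: d_ge2. Qed.

(** The opposite of $w_j$ belongs to the complement of $j$, which has $d \ge 2$ elements and is no
    singleton. This is what tells the two signs apart. *)
Lemma omega_set1_neq (i j : 'I_n) : om [set i] <> - om [set j].
Proof.
have jT : ~: [set j] != setT.
  by apply/eqP => /(congr1 (fun X : {set _} => #|X|)); rewrite cardsC1 cardsT card_ord; lia.
rewrite -omegaC // => /(omega_inj d_gt0 k_gt0 (set1_neqT n_ge3 i) jT).
by move/(congr1 (fun X : {set _} => #|X|)); rewrite cards1 cardsC1 card_ord; lia.
Qed.

(** Expresses in Z/N that three vertices, possibly equal, lie in a common face. Excluding the full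
    set, whose residue is 0 like that of the empty set, makes [S] and [T] unique. *)
Definition triangle x y z := exists S T,
  [/\ S != setT, T != setT, comparable S T, y = x + om S & z = x + om T].

Lemma triangle_omega x S T : S != setT -> T != setT ->
  triangle x (x + om S) (x + om T) -> comparable S T.
Proof.
move=> ST TT [S' [T' [S'T T'T c /addrI eS /addrI eT]]].
by rewrite (omega_inj d_gt0 k_gt0 ST S'T eS) (omega_inj d_gt0 k_gt0 TT T'T eT).
Qed.

Variable p : 'Z_N -> 'Z_N.
Hypotheses (p_inj : injective p)
  (p_tri : forall x y z, triangle (p x) (p y) (p z) <-> triangle x y z).

(** Reading the neighbours of [x] and of [p x] as subsets turns [p] into a map of subsets preserving
    comparability; complementation then becomes the sign. *)
Lemma vertex_map_local x : exists (e : bool) (s : {perm 'I_n}),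
  forall S, p (x + om S) = p x + (-1) ^+ e * om (s @: S).
Proof.
have T0 : [set: 'I_n] != set0 by rewrite -card_gt0 cardsT card_ord.
(* At the full set [f0] takes an arbitrary value, which [f] replaces below by the full set. *)
have /fin_all_exists [f0 hf0] S : exists T, S != setT -> T != setT /\ p (x + om S) = p x + om T.
  have [->|ST] := eqVneq S setT; first by exists set0.
  have [|T [_ [TT _ _ e _]]] := (p_tri x (x + om S) (x + om S)).2.
    by exists S, S; split=> //; rewrite /comparable subxx.
  by exists T.
pose f S := if S == setT then setT else f0 S.
have fT : f setT = setT by rewrite /f eqxx.
have fE S : S != setT -> f S != setT /\ p (x + om S) = p x + om (f S).
  by move=> ST; rewrite /f (negPf ST); apply: hf0.
have fa : comparability_aut f.
  have finj : injective f.
    move=> S T e; have [ST|ST] := eqVneq S setT; have [TT|TT] := eqVneq T setT.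
    - by rewrite ST TT.
    - by have [] := fE T TT; rewrite -e ST fT eqxx.
    - by have [] := fE S ST; rewrite e TT fT eqxx.
    have [_ eS] := fE S ST; have [_ eT] := fE T TT.
    apply: (omega_inj d_gt0 k_gt0 ST TT).
    by apply: (@addrI _ x); apply: p_inj; rewrite eS eT e.
  have f00 : f set0 = set0.
    have [h0 e0] := fE set0 (introN eqP (fun e => negP T0 (introT eqP (esym e)))).
    apply: (omega_inj d_gt0 k_gt0 h0); first by rewrite eq_sym.
    by apply: (@addrI _ (p x)); rewrite -e0 omega0 !addr0.
  split=> // S T.
  have cT X : comparable setT X by rewrite /comparable subsetT orbT.
  have cT' X : comparable X setT by rewrite /comparable subsetT.
  have [->|ST] := eqVneq S setT; first by rewrite fT !cT.
  have [->|TT] := eqVneq T setT; first by rewrite fT !cT'.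
  have [fS eS] := fE S ST; have [fT' eT] := fE T TT.
  apply/idP/idP => c.
    apply: (triangle_omega (x := x) ST TT); apply/p_tri; rewrite eS eT.
    by exists (f S), (f T).
  apply: (triangle_omega (x := p x) fS fT'); rewrite -eS -eT; apply/p_tri.
  by exists S, T.
have pE S : p (x + om S) = p x + om (f S).
  have [->|ST] := eqVneq S setT; last by have [] := fE S ST.
  by rewrite fT omegaT // !addr0.
have [s [fs|fs]] := comparability_autP n_ge3 fa.
  by exists false, s => S; rewrite pE fs expr0 mul1r.
exists true, s => S; rewrite pE expr1 mulN1r.
have [_ f00 _ _] := fa.
have [->|S0] := eqVneq S set0; first by rewrite f00 imset0 !omega0 oppr0.
have [->|ST] := eqVneq S setT.
  rewrite fT (_ : s @: setT = setT) ?omegaT ?oppr0 //.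
  by apply/setP=> i; rewrite inE -[i](permKV s) mem_imset ?inE //; apply: perm_inj.
by rewrite fs // omegaC.
Qed.

(** For $j \ne 0$ the vertex $x + w_0 + w_j$ is seen both from $x$ and from $x + w_0$. Comparing its
    two images gives the sign and the values of [s] off 0; the value at 0 is the only one left. *)
Lemma vertex_map_propagate x (e e' : bool) (s s' : {perm 'I_n}) :
  (forall S, p (x + om S) = p x + (-1) ^+ e * om (s @: S)) ->
  (forall S, p (x + om [set ord0] + om S) =
             p (x + om [set ord0]) + (-1) ^+ e' * om (s' @: S)) ->
  e' = e /\ s' = s.
Proof.
move=> hs hs'.
have key (j : 'I_n) : j != ord0 -> (-1) ^+ e * om [set s j] = (-1) ^+ e' * om [set s' j].
  move=> j0; have dis : [disjoint [set s ord0] & [set s j]].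
    by rewrite disjoints1 inE (inj_eq perm_inj) eq_sym.
  have := hs' [set j]; rewrite -addrA -omegaU //; last by rewrite disjoints1 inE eq_sym.
  rewrite !hs imsetU !imset_set1 (omegaU _ dis) mulrDr -!addrA => /addrI/addrI.
  by [].
have j1 : inord 1 != ord0 :> 'I_n by rewrite -val_eqE /= inordK.
have ee : e' = e.
  have := key _ j1; case: (e) (e') => -[] //; rewrite expr0 expr1 mul1r mulN1r.
    by move/esym/omega_set1_neq.
  by move/omega_set1_neq.
split=> //; subst e'.
have sE j : j != ord0 -> s' j = s j.
  move=> /key /(mulrI (unitrX _ (unitrN1 _))) h.
  by apply/esym/set1_inj/(omega_inj d_gt0 k_gt0) => //; apply: set1_neqT n_ge3 _.
apply/permP => i; have [->|/sE //] := eqVneq i ord0.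
have [j hj] : exists j, s j = s' ord0 by exists (s^-1 (s' ord0))%g; rewrite permKV.
have [j0|/sE] := eqVneq j ord0; first by rewrite -j0 in hj *.
by rewrite hj => /perm_inj j0; rewrite -hj j0.
Qed.

(** Along the multiples of $w_0$, which fill Z/N, the sign and [s] stay constant, and each step adds
    $\pm w_{s(0)} = \pm q^{s(0)} w_0$ to the image. *)
Lemma vertex_map_affine : exists (e : bool) (m : 'I_n),
  forall x, p x = p 0 + (-1) ^+ e * (ratio d k ^+ m * x).
Proof.
have [e [s hs]] := vertex_map_local 0.
have w0U := weight0_unit d_gt0 k_gt0.
have gen x : exists m : nat, x = om [set ord0] *+ m.
  have [v <-] : exists v : 'Z_N, v * (weight d k 0)%:R = x.
    by exists (x / (weight d k 0)%:R); rewrite divrK.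
  by exists (nat_of_ord v); rewrite omega1 -[RHS]mulr_natl natr_Zp.
have all m S : p (om [set ord0] *+ m + om S) = p (om [set ord0] *+ m) + (-1) ^+ e * om (s @: S).
  elim: m S => [|m IH] S; first by rewrite mulr0n hs.
  have [e' [s' hs']] := vertex_map_local (om [set ord0] *+ m.+1).
  move: hs'; rewrite mulrSr => hs'.
  by have [ee ss] := vertex_map_propagate IH hs'; rewrite hs' ee ss.
exists e, (s ord0) => x; have [m ->] := gen x.
elim: m => [|m IH]; first by rewrite mulr0n !mulr0 addr0.
rewrite mulrSr all IH imset_set1 [om [set s _]]omega1 weight_ratioX //.
by rewrite -addrA -mulrDr -mulrDr omega1.
Qed.
End Rigidity.

From mathcomp Require Import boolp classical_sets functions cardinality reals.
Local Open Scope classical_set_scope.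
Local Open Scope card_scope.

(** * Faces of the arrangement *)

Section Geometry.
Variables (R : realType) (d : nat).
Local Notation n := d.+1.
Local Notation E := 'rV[R]_n.
Implicit Types (x y z : E) (a b : 'rV[int]_n) (S T : {set 'I_n}) (F G : set E).

Definition lattice_point a : E := \sum_(i < n) wt R i *~ a 0 i.
Local Notation pt := lattice_point.

Lemma wtE (i j : 'I_n) : wt R i 0 j = (i == j)%:R - (n%:R)^-1.
Proof.
rewrite /wt !mxE eqxx /= eq_sym summxE (bigD1 j) //= big1 => [|l lj].
  by rewrite !mxE !eqxx addr0 mulr1.
by rewrite !mxE eq_sym (negPf lj).
Qed.

Lemma lattice_pointE a j :
  pt a 0 j = (a 0 j)%:~R - (n%:R)^-1 * (\sum_i a 0 i)%:~R.
Proof.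
rewrite summxE (eq_bigr (fun i => (a 0 i)%:~R * (i == j)%:R - (n%:R)^-1 * (a 0 i)%:~R)).
  rewrite sumrB -mulr_sumr rmorph_sum; congr (_ - _).
  by rewrite (bigD1 j) //= eqxx mulr1 big1 ?addr0 // => i /negPf->; rewrite mulr0.
by move=> i _; rewrite -scaler_int mxE wtE mulrBr [_^-1 * _]mulrC.
Qed.

(** The hyperplanes see only coordinate differences, in which the subtracted mean cancels; this
    reduces lattice points to integer rows. *)
Lemma lattice_point_diff a i j : pt a 0 j - pt a 0 i = (a 0 j - a 0 i)%:~R.
Proof. by rewrite !lattice_pointE rmorphB opprD addrACA subrr addr0. Qed.

Lemma lattice_pointV a : hyperplaneV (pt a).
Proof.
rewrite /hyperplaneV /=; under eq_bigr do rewrite lattice_pointE.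
rewrite sumrB sumr_const card_ord -[X in _ - X]mulr_natl mulrA divff ?pnatr_eq0 // mul1r.
by rewrite rmorph_sum subrr.
Qed.

Lemma lattice_pointD a b : pt (a + b) = pt a + pt b.
Proof. by rewrite -big_split; apply: eq_bigr => i _; rewrite mxE mulrzDr. Qed.

Lemma lattice_pointN a : pt (- a) = - pt a.
Proof. by rewrite /pt -sumrN; apply: eq_bigr => i _; rewrite mxE mulrNz. Qed.

Lemma lattice_pointB a b : pt (a - b) = pt a - pt b.
Proof. by rewrite lattice_pointD lattice_pointN. Qed.

Lemma lattice_point0 : pt 0 = 0.
Proof. by rewrite -(subrr 0) lattice_pointB subrr. Qed.

Lemma lattice_point_shift a : cyclic_shift (pt a) = pt (row_shift a).
Proof.
apply/rowP => j; rewrite mxE !lattice_pointE mxE; congr (_ - _ * _%:~R).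
rewrite (reindex_inj (can_inj (@ord_predK n))) /=.
by apply: eq_bigr => i _; rewrite mxE.
Qed.

Lemma hyperplaneV_ext x y : hyperplaneV x -> hyperplaneV y ->
  (forall i j, x 0 j - x 0 i = y 0 j - y 0 i) -> x = y.
Proof.
move=> Vx Vy h.
have e j : x 0 j = y 0 j + (x 0 ord0 - y 0 ord0).
  by rewrite addrCA -(h ord0 j) addrC subrK.
move: (Vx); rewrite /hyperplaneV /=; under eq_bigr do rewrite e.
rewrite big_split /= Vy add0r sumr_const card_ord => /eqP.
rewrite mulrn_eq0 /= => /eqP h0.
by apply/rowP => j; rewrite e h0 addr0.
Qed.

Lemma lattice_point_eq a b : pt a = pt b <-> forall i j, a 0 j - a 0 i = b 0 j - b 0 i.
Proof.
split=> [e i j|h].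
  by apply: (@intr_inj R); rewrite -!lattice_point_diff e.
apply: hyperplaneV_ext; try exact: lattice_pointV.
by move=> i j; rewrite !lattice_point_diff h.
Qed.

(** A lower bound for the pair $(i, j)$ is an upper bound for $(j, i)$, so upper bounds over all
    ordered pairs suffice. *)
Lemma closed_faceE x y : closed_face x y <->
  hyperplaneV y /\ forall i j (m : int), x 0 j - x 0 i <= m%:~R -> y 0 j - y 0 i <= m%:~R.
Proof.
split=> -[Vy h]; split=> // i j m; last first.
  move=> ij; split; first exact: h.
  by have := h j i (- m); rewrite rmorphN -(opprB (x 0 j)) -(opprB (y 0 j)) !lerN2.
have [ij|ji|/val_inj->] := ltngtP i j; first by have [] := h i j m ij.
  have [_] := h j i (- m) ji.
  by rewrite rmorphN -(opprB (x 0 j)) -(opprB (y 0 j)) !lerN2.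
by rewrite !subrr.
Qed.

Lemma closed_face_self x : hyperplaneV x -> closed_face x x.
Proof. by move=> Vx; apply/closed_faceE. Qed.

Lemma closed_face_lattice x a : closed_face x (pt a) <->
  forall i j (m : int), x 0 j - x 0 i <= m%:~R -> a 0 j - a 0 i <= m.
Proof.
split=> [/closed_faceE[_ h] i j m /h|h].
  by rewrite lattice_point_diff ler_int.
apply/closed_faceE; split; first exact: lattice_pointV.
by move=> i j m /h; rewrite lattice_point_diff ler_int.
Qed.

Definition ceil_row i x : 'rV[int]_n := \row_l Num.ceil (x 0 l - x 0 i).

(** Rounding up is monotone and commutes with adding an integer $m$, so a bound $x_q \le x_p + m$
    survives it. *)
Lemma ceil_row_face i x : closed_face x (pt (ceil_row i x)).
Proof.
apply/closed_face_lattice => p q m pq; rewrite !mxE lerBlDr ceil_le_int rmorphD /=.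
apply: (@le_trans _ _ (m%:~R + (x 0 p - x 0 i))); last by rewrite lerD2l ceil_ge.
by rewrite -(subrKA (x 0 p)) lerD2r.
Qed.

(* The vertex ceil_row i x maximises, over the face of x, all the differences
   y_j - y_i with this i. *)
Lemma closed_face_sub x z :
  (forall a, closed_face x (pt a) -> closed_face z (pt a)) ->
  closed_face x `<=` closed_face z.
Proof.
move=> h y /closed_faceE[Vy hy]; apply/closed_faceE; split=> // i j m zm.
apply: hy; rewrite -ceil_le_int.
have /h/closed_face_lattice/(_ i j m zm) := ceil_row_face i x.
by rewrite !mxE subrr ceil0 subr0.
Qed.

Lemma closed_face_point a y : closed_face (pt a) y -> y = pt a.
Proof.
move=> /closed_faceE[Vy h]; apply: hyperplaneV_ext => //; first exact: lattice_pointV.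
move=> i j; apply/eqP; rewrite eq_le; apply/andP; split.
  by rewrite lattice_point_diff; apply: h; rewrite lattice_point_diff.
rewrite -lerN2 !opprB lattice_point_diff.
by apply: h; rewrite lattice_point_diff.
Qed.

(** The differences $b_j - b_i$ and $a_i - a_j$ are bounded by the ceilings of two opposite reals,
    and these add up to at most 1. *)
Lemma closed_face_diff x a b i j : closed_face x (pt a) -> closed_face x (pt b) ->
  (b - a) 0 j - (b - a) 0 i <= 1.
Proof.
move=> /closed_face_lattice/(_ j i _ (ceil_ge _)) ha.
move=> /closed_face_lattice/(_ i j _ (ceil_ge _)) hb.
rewrite !mxE.
have c : Num.ceil (x 0 j - x 0 i) + Num.ceil (x 0 i - x 0 j) <= 1.
  rewrite -ltzD1 -(ltr_int R) !rmorphD /=.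
  have /andP[h1 _] := ceil_itv (x 0 j - x 0 i).
  have /andP[h2 _] := ceil_itv (x 0 i - x 0 j).
  by move: h1 h2; rewrite !rmorphB /=; lra.
by rewrite opprD opprK addrACA [- a 0 j + _]addrC (le_trans (lerD hb ha)).

Qed.

(** The entries take at most two consecutive values; [S] collects those above the minimum, and is
    proper because the minimum is attained. *)
Lemma row_of_set_diff (u : 'rV[int]_n) : (forall i j, u 0 j - u 0 i <= 1) ->
  exists2 S, S != [set: 'I_n]%SET & forall i j, u 0 j - u 0 i = row_of_set S 0 j - row_of_set S 0 i.
Proof.
move=> h; have [i0 _ i0min] := @arg_minP _ _ _ ord0 xpredT (fun i => u 0 i) isT.
exists [set i | u 0 i0 < u 0 i]%SET.
  by apply/eqP => /setP/(_ i0); rewrite !inE ltxx.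
have e i : u 0 i = u 0 i0 + ((u 0 i0 < u 0 i)%R : nat)%:Z.
  have := h i0 i; have := i0min i isT.
  by case: ltP => /=; lia.
by move=> i j; rewrite !mxE !inE (e i) (e j); lia.
Qed.

Lemma triangle_face a S T : S \subset T -> exists x,
  [/\ hyperplaneV x, closed_face x (pt a), closed_face x (pt (a + row_of_set S)) &
      closed_face x (pt (a + row_of_set T))].
Proof.
move=> /fintype.subsetP ST.
(* The barycentre of the three vertices; its bounds become integer inequalities after multiplication
   by 3. *)
exists (pt a + 3^-1 *: (pt (row_of_set S) + pt (row_of_set T))).
set x := (_ + _).
have xE i j : x 0 j - x 0 i = (a 0 j - a 0 i)%:~R + 3^-1 *
   (((j \in S)%:Z - (i \in S)%:Z)%:~R + ((j \in T)%:Z - (i \in T)%:Z)%:~R).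
  have eS := lattice_point_diff (row_of_set S) i j.
  have eT := lattice_point_diff (row_of_set T) i j.
  have ea := lattice_point_diff a i j.
  rewrite -ea; move: eS eT; rewrite !mxE => <- <-; lra.
split.
- have := lattice_pointV a; have := lattice_pointV (row_of_set S).
  have := lattice_pointV (row_of_set T); rewrite /hyperplaneV /= => hT hS ha.
  under eq_bigr do rewrite !mxE.
  by rewrite big_split /= -mulr_sumr big_split /= hT hS ha addr0 mulr0 addr0.
all: apply/closed_face_lattice => i j m; rewrite xE -(ler_pM2l (_ : 0 < 3 :> R)) //.
all: rewrite mulrDr mulVKf ?pnatr_eq0 // (_ : 3 = 3%:~R :> R) // -!(rmorphM, rmorphD) ler_int ?mxE.
all: have := ST i; have := ST j.
all: case: (i \in S) (i \in T) (j \in S) (j \in T) => [] [] [] [] /= h1 h2;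
  try (by have := h1 isT); try (by have := h2 isT); lia.
Qed.
End Geometry.

(** * Translations, reflection and cyclic shift as symmetries of the arrangement *)

Section FaceSymmetries.
Variables (R : realType) (d : nat).
Local Notation n := d.+1.
Local Notation V := 'rV[R]_n.
Local Notation pt := (@lattice_point R d).
Implicit Types (x y : V) (a b : 'rV[int]_n) (F : set V).

Lemma closed_faceD a x y : closed_face x y -> closed_face (x + pt a) (y + pt a).
Proof.
move=> /closed_faceE[Vy h]; apply/closed_faceE; split.
  have := lattice_pointV R a; rewrite /hyperplaneV /= => ha.
  under eq_bigr do rewrite mxE.
  by rewrite big_split /= ha Vy addr0.
move=> i j m.
have e (u : V) : (u + pt a) 0 j - (u + pt a) 0 i =
    u 0 j - u 0 i + (a 0 j - a 0 i)%:~R.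
  by rewrite ![(u + _) 0 _]mxE opprD addrACA lattice_point_diff.
by rewrite !e; have := h i j (m - (a 0 j - a 0 i)); rewrite intrB !lerBrDr.
Qed.

Lemma closed_faceN x y : closed_face x y -> closed_face (- x) (- y).
Proof.
move=> /closed_faceE[Vy h]; apply/closed_faceE; split.
  by rewrite /hyperplaneV /=; under eq_bigr do rewrite mxE; rewrite sumrN Vy oppr0.
by move=> i j m; rewrite !mxE !opprK ![- _ + _]addrC; apply: h.
Qed.

Lemma closed_face_shift x y :
  closed_face x y -> closed_face (cyclic_shift x) (cyclic_shift y).
Proof.
move=> /closed_faceE[Vy h]; apply/closed_faceE; split.
  rewrite /hyperplaneV /=; under eq_bigr do rewrite mxE.
  by rewrite -[RHS]Vy [RHS](reindex_inj (can_inj (@ord_predK n))).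
by move=> i j m; rewrite !mxE; apply: h.
Qed.

Definition cyclic_unshift x : V := \row_i x 0 (ordS i).

Lemma cyclic_shiftK : cancel (@cyclic_shift R d) cyclic_unshift.
Proof. by move=> x; apply/rowP => i; rewrite !mxE ordSK. Qed.

Lemma cyclic_unshiftK : cancel cyclic_unshift (@cyclic_shift R d).
Proof. by move=> x; apply/rowP => i; rewrite !mxE ord_predK. Qed.

Lemma closed_face_unshift x y :
  closed_face x y -> closed_face (cyclic_unshift x) (cyclic_unshift y).
Proof.
move=> /closed_faceE[Vy h]; apply/closed_faceE; split.
  rewrite /hyperplaneV /=; under eq_bigr do rewrite mxE.
  by rewrite -[RHS]Vy [RHS](reindex_inj (can_inj (@ordSK n))).
by move=> i j m; rewrite !mxE; apply: h.
Qed.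

Definition row_unshift a : 'rV[int]_n := \row_i a 0 (ordS i).

Lemma lattice_point_unshift a : cyclic_unshift (pt a) = pt (row_unshift a).
Proof.
apply: (can_inj cyclic_shiftK); rewrite cyclic_unshiftK lattice_point_shift.
by congr pt; apply/rowP => i; rewrite !mxE ord_predK.
Qed.

Lemma image_closed_face (g g' : V -> V) x : cancel g g' -> cancel g' g ->
  (forall y z, closed_face y z -> closed_face (g y) (g z)) ->
  (forall y z, closed_face y z -> closed_face (g' y) (g' z)) ->
  g @` closed_face x = closed_face (g x).
Proof.
move=> gK g'K hg hg'; apply/seteqP; split=> [_ [y xy <-]|y xy]; first exact: hg.
by exists (g' y); rewrite ?g'K // -[x]gK; apply: hg'.
Qed.

Lemma translate_closed_face a x :
  translate (pt a) (closed_face x) = closed_face (x + pt a).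
Proof.
apply: (image_closed_face (g' := fun y => y + pt (- a))); try exact: closed_faceD.
- by move=> y; rewrite lattice_pointN addrK.
- by move=> y; rewrite lattice_pointN subrK.
Qed.
End FaceSymmetries.

(** * Faces of the quotient complex and their vertices *)

Section QuotientComplex.
Variables (R : realType) (d k : nat).
Hypotheses (d_ge2 : (1 < d)%N) (k_gt0 : (0 < k)%N).
Local Notation n := d.+1.
Local Notation N := (modulus d k).
Local Notation V := 'rV[R]_n.
Local Notation pt := (@lattice_point R d).
Local Notation kk := (fun _ : 'I_n => k).
Local Notation K := (Tk (R := R) kk).
Local Notation ph := (@phi d k).
Local Notation om := (@omega d k).
Implicit Types (x y : V) (a b : 'rV[int]_n) (F : set V) (c : K) (z : 'Z_N).

Let d_gt0 : (0 < d)%N. Proof. exact: ltnW. Qed.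

Lemma LlatP x : Llat kk x <-> exists2 b, x = pt b & ph b = 0.
Proof.
split=> [[b ->]|[b -> /(phi_ker d_gt0 k_gt0)[e ->]]]; last by exists e.
by exists (b *m Mmx kk); rewrite ?phi_Mmx.
Qed.

Lemma pt_phi a b : pt a = pt b -> ph a = ph b.
Proof. by move=> /lattice_point_eq; apply: phi_eq. Qed.

Lemma classP c F : val c F ->
  exists x, [/\ hyperplaneV x, F = closed_face x & val c = face_class kk F].
Proof.
case: c => c /= hc; have /set_mem [_ [x Vx ->] cE] := hc.
rewrite cE => -[l /LlatP[b lE pb] FE].
exists (x + pt b); rewrite FE lE translate_closed_face; split=> //.
  by have /closed_faceE[] := closed_faceD b (closed_face_self Vx).
apply/seteqP; split=> _ [_ /LlatP[e -> pe] ->].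
  exists (pt (e - b)); first by apply/LlatP; exists (e - b); rewrite // phiB pb pe subrr.
  by rewrite !translate_closed_face lattice_pointB -addrA [pt b + _]addrC subrK.
exists (pt (e + b)); first by apply/LlatP; exists (e + b); rewrite // phiD pb pe addr0.
by rewrite !translate_closed_face lattice_pointD addrA addrAC.
Qed.

Definition verts c : set 'Z_N :=
  [set z | exists F a, [/\ val c F, F (pt a) & ph a = z]].

Lemma class_refl x : face_class kk (closed_face x) (closed_face x).
Proof.
exists (pt 0); first by apply/LlatP; exists 0; rewrite // -(subrr 0) phiB subrr.
by rewrite translate_closed_face lattice_point0 addr0.
Qed.

Lemma class_in_Tk x : hyperplaneV x -> face_class kk (closed_face x) \in K.
Proof. by move=> Vx; apply/mem_set; exists (closed_face x) => //; exists x. Qed.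

Lemma face_in_class x : hyperplaneV x -> exists c, val c (closed_face x).
Proof.
move=> Vx; exists (exist _ (face_class kk (closed_face x)) (class_in_Tk Vx)).
exact: class_refl.
Qed.

Lemma class_face c : exists2 x, hyperplaneV x & val c (closed_face x).
Proof.
case: c => c /= hc; have /set_mem [_ [x Vx ->] ->] := hc.
by exists x => //; apply: class_refl.
Qed.

Lemma class_translate c x b : val c (closed_face x) -> ph b = 0 ->
  val c (closed_face (x + pt b)).
Proof.
move=> cx pb; have [y [_ _ ->]] := classP cx.
by exists (pt b); rewrite ?translate_closed_face //; apply/LlatP; exists b.
Qed.

Lemma class_faces c x y : val c (closed_face x) -> val c (closed_face y) ->
  exists2 b, closed_face y = closed_face (x + pt b) & ph b = 0.
Proof.
move=> cx; have [x' [_ _ ->]] := classP cx => -[_ /LlatP[b -> pb] ->].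
by exists b; rewrite // translate_closed_face.
Qed.

Lemma class_inj c c' x : val c (closed_face x) -> val c' (closed_face x) -> c = c'.
Proof.
by move=> /classP[_ [_ _ e]] /classP[_ [_ _ e']]; apply: val_inj; rewrite e e'.
Qed.

Lemma closed_face_subD x a b :
  closed_face (x + pt b) (pt a) -> closed_face x (pt (a - b)).
Proof.
move=> /(closed_faceD (- b)); rewrite lattice_pointN addrK.
by rewrite lattice_pointB.
Qed.

(** One representative suffices: any other is a translate by a vector of residue zero. *)
Lemma vertsP c x z : val c (closed_face x) ->
  verts c z <-> exists2 a, closed_face x (pt a) & ph a = z.
Proof.
move=> cx; split=> [[F [a [cF Fa <-]]]|[a xa <-]]; last by exists (closed_face x), a.
have [y [_ Fy _]] := classP cF; subst F.
have [b e pb] := class_faces cx cF; rewrite e in Fa.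
by exists (a - b); [apply: closed_face_subD|rewrite phiB pb subr0].
Qed.

Lemma verts_neq0 c : exists z, verts c z.
Proof.
have [x _ cx] := class_face c.
by exists (ph (ceil_row ord0 x)), (closed_face x), (ceil_row ord0 x); split=> //; apply: ceil_row_face.
Qed.

Lemma face_omega x a b : closed_face x (pt a) -> closed_face x (pt b) ->
  exists2 S, S != [set: 'I_n]%SET &
    forall i j, (b - a) 0 j - (b - a) 0 i = row_of_set S 0 j - row_of_set S 0 i.
Proof. by move=> xa xb; apply: row_of_set_diff => i j; apply: closed_face_diff xa xb. Qed.

Lemma face_phi a b (S : {set 'I_n}) :
  (forall i j, (b - a) 0 j - (b - a) 0 i = row_of_set S 0 j - row_of_set S 0 i) ->
  ph b = ph a + om S.
Proof.
move=> /(phi_eq d_gt0 k_gt0); rewrite phiB // phi_row_of_set // => <-.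
by rewrite addrC subrK.
Qed.

(** Links the combinatorics of Z/N to the complex: [face_omega] finds the subsets, and
    [triangle_face] builds a face from comparable ones. *)
Lemma verts_triangle (x y z : 'Z_N) :
  (exists c, [/\ verts c x, verts c y & verts c z]) <-> triangle x y z.
Proof.
split=> [[c [cx cy cz]]|[S [T [ST TT cST -> ->]]]].
  have [u _ cu] := class_face c.
  have /vertsP-/(_ _ cu)[a ua <-] := cx; have /vertsP-/(_ _ cu)[b ub <-] := cy.
  have /vertsP-/(_ _ cu)[e ue <-] := cz.
  have [S ST hS] := face_omega ua ub; have [T TT hT] := face_omega ua ue.
  exists S, T; split=> //; [|exact: face_phi hS|exact: face_phi hT].
  (* If [S] and [T] were incomparable, the coordinates $i$ and $j$ of $e - b$ would differ by 2, too
     much for one face. *)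
  apply: contraT; rewrite negb_or => /andP[/subsetPn[i iS iT] /subsetPn[j jT jS]].
  have := closed_face_diff i j ub ue.
  have -> : e - b = (e - a) - (b - a) by rewrite opprB addrA subrK.
  move: (hS i j) (hT i j); rewrite {hS hT}; move: (b - a) (e - a) => v w.
  rewrite !mxE iS jT (negPf iT) (negPf jS) ?subr0 ?sub0r => hv hw.
  by rewrite opprD opprK addrACA hw [- v 0 j + _]addrC -opprB hv.
have [a <-] := phi_surj d_gt0 k_gt0 x.
have [u [Vu ua uS uT]] : exists u, [/\ hyperplaneV u, closed_face u (pt a),
    closed_face u (pt (a + row_of_set S)) & closed_face u (pt (a + row_of_set T))].
  case/orP: cST => /(triangle_face R a) [u [Vu ua u1 u2]]; exists u; split=> //.
have [c cu] := face_in_class Vu.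
exists c; split; apply/(vertsP _ cu); first by exists a.
  by exists (a + row_of_set S); rewrite // phiD // phi_row_of_set.
by exists (a + row_of_set T); rewrite // phiD // phi_row_of_set.
Qed.

(** A shared lattice vertex lifts inclusions from residues to points: every other vertex of either
    face differs from it by some $w_S$, and the residue determines [S]. *)
Lemma verts_sub_face c c' x x' a :
  val c (closed_face x) -> val c' (closed_face x') ->
  closed_face x (pt a) -> closed_face x' (pt a) -> verts c `<=` verts c' ->
  closed_face x `<=` closed_face x'.
Proof.
move=> cx cx' xa xa' sub; apply: closed_face_sub => b xb.
have /sub/(vertsP _ cx')[b' xb' e] : verts c (ph b) by apply/(vertsP _ cx); exists b.
have [S ST hS] := face_omega xa xb; have [T TT hT] := face_omega xa' xb'.
have ST' : S = T.
  apply: (omega_inj d_gt0 k_gt0 ST TT); apply: (@addrI _ (ph a)).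
  by rewrite -(face_phi hS) -(face_phi hT).
have -> : pt b = pt b'; last by [].
rewrite -(subrK a b) -(subrK a b') !(@lattice_pointD _ _ (_ - _)); congr (_ + _).
by apply/lattice_point_eq => i j; rewrite hS hT ST'.
Qed.

Lemma verts_align c a : verts c (ph a) ->
  exists2 x, val c (closed_face x) & closed_face x (pt a).
Proof.
move=> ca; have [x _ cx] := class_face c; have /(vertsP _ cx)[b xb e] := ca.
exists (x + pt (a - b)).
  by apply: class_translate => //; rewrite phiB // e subrr.
have := closed_faceD (a - b) xb.
by rewrite -lattice_pointD [b + _]addrC subrK.
Qed.

(** For the converse, representatives are translated until they share a vertex, so that
    [verts_sub_face] applies. *)
Lemma containedP c c' : contained c c' <-> verts c `<=` verts c'.
Proof.
split=> [[F [G [cF cG FG]]] z|sub].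
  have [x [_ Fx _]] := classP cF; subst F.
  move=> /(vertsP _ cF)[a /FG Ga <-]; by exists G, a.
have [x _ cx] := class_face c.
have [z cz] := verts_neq0 c; have /(vertsP _ cx)[a xa za] := cz; subst z.
have [x' cx' xa'] := verts_align (sub _ cz).
by exists (closed_face x), (closed_face x'); split=> //; exact: (verts_sub_face cx cx' xa xa' sub).
Qed.

Lemma verts_inj : injective verts.
Proof.
move=> c c' e; have [x _ cx] := class_face c.
have [z cz] := verts_neq0 c; have /(vertsP _ cx)[a xa za] := cz; subst z.
rewrite e in cz; have [x' cx' xa'] := verts_align cz.
apply: (@class_inj _ _ x) => //; suff -> : closed_face x = closed_face x' by [].
apply/seteqP; split.
  by apply: (verts_sub_face cx cx' xa xa'); rewrite e.
by apply: (verts_sub_face cx' cx xa' xa); rewrite e.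
Qed.

Lemma vertex_class z : exists c, verts c = [set z].
Proof.
have [a <-] := phi_surj d_gt0 k_gt0 z.
have [c cx] := face_in_class (lattice_pointV R a).
exists c; apply/seteqP; split=> y /=.
  by move=> /(vertsP _ cx)[b /closed_face_point/pt_phi-> <-].
by move=> ->; apply/(vertsP _ cx); exists a => //; apply/closed_face_self/lattice_pointV.
Qed.

(** * Automorphisms and their vertex maps *)

Definition vertex_map (f : K -> K) (p : 'Z_N -> 'Z_N) :=
  forall c, verts (f c) = p @` verts c.

Lemma vertex_map_unique f g p : vertex_map f p -> vertex_map g p -> f = g.
Proof. by move=> hf hg; apply/funext => c; apply: verts_inj; rewrite hf hg. Qed.

Lemma vertex_map_fun_unique f p q : vertex_map f p -> vertex_map f q -> p = q.
Proof.
move=> hp hq; apply/funext => z; have [c cz] := vertex_class z.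
have := hp c; rewrite hq cz !image_set1 => /seteqP[/(_ (q z) erefl) /= e _].
by rewrite e.
Qed.

Lemma vertex_map_comp f g p q : vertex_map f p -> vertex_map g q ->
  vertex_map (f \o g) (p \o q).
Proof. by move=> hf hg c; rewrite /= hf hg image_comp. Qed.

(** Vertices are the minimal faces for containment, so an automorphism permutes them and respects
    their incidence with faces. *)
Lemma automorphism_vertex_map f : automorphism R kk f ->
  exists2 p, injective p & vertex_map f p.
Proof.
move=> [[g fK gK] hf].
have [vc hvc] := choice vertex_class.
have minimal c z : verts c `<=` [set z] -> c = vc z.
  move=> sub; apply: verts_inj; rewrite hvc; apply/seteqP; split=> // y /= ->.
  by have [w cw] := verts_neq0 c; rewrite -(sub _ cw).
have mem c z : verts c z <-> contained (vc z) c.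
  by rewrite containedP hvc; split=> [cz y /= ->|] //; apply.
(* Pulling a vertex of [f (vc z)] back along the inverse of [f] gives a face contained in [vc z],
   hence [vc z] itself. *)
have im z : exists w, f (vc z) = vc w.
  have [w /mem hw] := verts_neq0 (f (vc z)); exists w; move: hw.
  rewrite -[in X in X -> _](gK (vc w)) hf containedP hvc => /minimal <-.
  by rewrite gK.
have [p hp] := choice im.
have vc_inj z w : vc z = vc w -> z = w.
  by move=> e; have : verts (vc z) w; [rewrite e hvc|rewrite hvc].
exists p => [z w e|c].
  by apply/vc_inj/(can_inj fK); rewrite !hp e.
apply/seteqP; split=> [w /mem|_ [z /mem cz <-]]; last first.
  by apply/mem; rewrite -hp hf.
rewrite -{1}(gK (vc w)) hf => wc.
have [z /mem hz] := verts_neq0 (g (vc w)).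
have e : g (vc w) = vc z.
  move: hz; rewrite -hf gK hp containedP !hvc => /(_ _ erefl) /= pz.
  by rewrite -[LHS](fK _) gK -pz -hp fK.
exists z; first by apply/mem; rewrite -e.
by apply: vc_inj; rewrite -hp -e gK.
Qed.

Lemma automorphism_affine f : automorphism R kk f -> exists (e : bool) (m : 'I_n) z,
  vertex_map f (fun x : 'Z_N => z + (-1) ^+ e * (ratio d k ^+ m * x)).
Proof.
move=> fa; have [p p_inj hp] := automorphism_vertex_map fa.
have [[g fK gK] _] := fa.
have [|e [m he]] := vertex_map_affine d_ge2 k_gt0 p_inj.
  move=> x y z; rewrite -!verts_triangle; split=> -[c [cx cy cz]]; last first.
    by exists (f c); rewrite hp; split; [exists x|exists y|exists z].
  exists (g c); move: cx cy cz; rewrite -(gK c) hp fK => -[? ? /p_inj <-] [? ? /p_inj <-].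
  by move=> [? ? /p_inj <-].
by exists e, m, (p 0) => c; rewrite hp; congr (_ @` _); apply/funext => x; rewrite -he.
Qed.

(** * Symmetries of the arrangement that descend to the quotient *)

(** Both [g] and its inverse preserve faces and lattice points, so that vertices can be carried
    forth and back; [p] is the effect of [g] on residues. *)
Definition lattice_symmetry (g : V -> V) (p : 'Z_N -> 'Z_N) :=
  exists (g' : V -> V) (h h' : 'rV[int]_n -> 'rV[int]_n),
  [/\ cancel g g', cancel g' g,
      forall x y, closed_face x y -> closed_face (g x) (g y),
      forall x y, closed_face x y -> closed_face (g' x) (g' y) &
      forall a, [/\ g (pt a) = pt (h a), g' (pt a) = pt (h' a) & ph (h a) = p (ph a)]].

Lemma lattice_symmetry_id : lattice_symmetry id id.
Proof. by exists id, id, id; split. Qed.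

Lemma lattice_symmetry_comp g1 g2 p1 p2 : lattice_symmetry g1 p1 ->
  lattice_symmetry g2 p2 -> lattice_symmetry (g1 \o g2) (p1 \o p2).
Proof.
move=> [g1' [h1 [h1' [K1 K1' F1 F1' P1]]]] [g2' [h2 [h2' [K2 K2' F2 F2' P2]]]].
exists (g2' \o g1'), (h1 \o h2), (h2' \o h1'); split.
- exact: can_comp.
- exact: can_comp.
- by move=> x y /F2/F1.
- by move=> x y /F1'/F2'.
move=> a; have [_ P1' _] := P1 a; have [P2a _ P2b] := P2 a.
have [P1a _ P1b] := P1 (h2 a); have [_ P2' _] := P2 (h1' a).
by rewrite /= P2a P1a P1' P2' P1b P2b.
Qed.

Lemma lattice_symmetryD b : lattice_symmetry (fun x => x + pt b) (fun z : 'Z_N => z + ph b).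
Proof.
exists (fun x => x + pt (- b)), (fun a => a + b), (fun a => a - b); split.
- by move=> x; rewrite lattice_pointN addrK.
- by move=> x; rewrite lattice_pointN subrK.
- by move=> x y; apply: closed_faceD.
- by move=> x y; apply: closed_faceD.
by move=> a; rewrite !lattice_pointD phiD.
Qed.

Lemma lattice_symmetryN : lattice_symmetry (fun x => - x) (fun z => - z).
Proof.
exists -%R, -%R, -%R; split; try exact: opprK; try exact: closed_faceN.
by move=> a; rewrite lattice_pointN phiN.
Qed.

Lemma lattice_symmetry_shift m :
  lattice_symmetry (iter m (@cyclic_shift R d)) (fun z => ratio d k ^+ m * z).
Proof.
elim: m => [|m IH].
  have -> : (fun z => ratio d k ^+ 0 * z) = id by apply/funext => z; rewrite expr0 mul1r.
  exact: lattice_symmetry_id.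
have -> : (fun z => ratio d k ^+ m.+1 * z) =
    (fun z => ratio d k * z) \o (fun z => ratio d k ^+ m * z).
  by apply/funext => z; rewrite /= exprS mulrA.
apply: lattice_symmetry_comp IH.
exists (@cyclic_unshift R d), (@row_shift d), (@row_unshift d); split.
- exact: cyclic_shiftK.
- exact: cyclic_unshiftK.
- exact: closed_face_shift.
- exact: closed_face_unshift.
by move=> a; rewrite lattice_point_shift lattice_point_unshift phi_shift.
Qed.

Lemma verts_image g p c c' x : lattice_symmetry g p ->
  val c (closed_face x) -> val c' (closed_face (g x)) -> verts c' = p @` verts c.
Proof.
move=> [g' [h [h' [gK g'K hg hg' hh]]]] cx cgx.
apply/seteqP; split=> [_ /(vertsP _ cgx)[b gxb <-]|_ [_ /(vertsP _ cx)[a xa <-] <-]].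
  have [_ hb _] := hh b; have [hhb _ ph'] := hh (h' b).
  exists (ph (h' b)).
    by apply/(vertsP _ cx); exists (h' b); rewrite // -hb -(gK x); apply: hg'.
  by rewrite -ph'; apply: pt_phi; rewrite -hhb -hb g'K.
have [ga _ pa] := hh a.
by apply/(vertsP _ cgx); exists (h a); rewrite // -ga; apply: hg.
Qed.

Lemma symmetryV g p x : lattice_symmetry g p -> hyperplaneV x -> hyperplaneV (g x).
Proof.
move=> [_ [_ [_ [_ _ hg _ _]]]] Vx.
by have /closed_faceE[] := hg _ _ (closed_face_self Vx).
Qed.

Lemma symmetry_image g p x : lattice_symmetry g p ->
  g @` closed_face x = closed_face (g x).
Proof. by move=> [g' [h [h' [gK g'K hg hg' _]]]]; apply: (image_closed_face (g' := g')). Qed.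

(** A class is determined by its vertices, so being induced by [g] can be tested on residues. *)
Lemma induced_vertex_map g p (f : K -> K) : lattice_symmetry g p ->
  induced g f <-> vertex_map f p.
Proof.
move=> gp; split=> [fi c|hf c F cF].
  have [x _ cx] := class_face c; apply: (verts_image gp cx).
  by rewrite -(symmetry_image x gp); apply: fi.
have [x [Vx Fx _]] := classP cF; subst F; rewrite (symmetry_image x gp).
have [c' cgx] := face_in_class (symmetryV gp Vx).
suff <- : c' = f c by [].
by apply: verts_inj; rewrite hf; apply: verts_image cgx.
Qed.

Lemma symmetry_exists g p : lattice_symmetry g p -> exists f, vertex_map f p.
Proof.
move=> gp; have im c : exists c', verts c' = p @` verts c.
  have [x Vx cx] := class_face c; have [c' cgx] := face_in_class (symmetryV gp Vx).
  by exists c'; apply: verts_image cgx.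
by have [f hf] := choice im; exists f.
Qed.

(** Containment is inclusion of vertex sets, which an injective [p] preserves and reflects;
    surjectivity comes from the inverse of [g]. *)
Lemma symmetry_automorphism g p f : lattice_symmetry g p -> injective p ->
  vertex_map f p -> automorphism R kk f.
Proof.
move=> gp p_inj hf.
have pim (X Y : set 'Z_N) : p @` X `<=` p @` Y <-> X `<=` Y.
  split=> [sub x Xx|sub]; last exact: image_subset.
  by have [y Yy /p_inj <-] := sub (p x) (ex_intro2 _ _ x Xx erefl).
have f_inj : injective f.
  move=> c c' e; apply: verts_inj; apply/seteqP.
  by split; apply/pim; rewrite -!hf e.
have f_surj c' : exists c, f c = c'.
  have [x Vx cx] := class_face c'; have gp' := gp.
  have [g' [h [h' [gK g'K hg hg' _]]]] := gp.
  have /closed_faceE[Vg'x _] := hg' _ _ (closed_face_self Vx).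
  have [c cg'x] := face_in_class Vg'x; exists c; apply: verts_inj; rewrite hf.
  by apply/esym/(verts_image gp' cg'x); rewrite g'K.
have [f' f'K] := choice f_surj; split.
  by exists f' => // c; apply: f_inj; rewrite f'K.
by move=> c c'; rewrite !containedP !hf.
Qed.

(** * Generation and order of the automorphism group *)

Definition affine_map (t : 'Z_N * bool * 'I_n) (x : 'Z_N) : 'Z_N :=
  t.1.1 + (-1) ^+ t.1.2 * (ratio d k ^+ t.2 * x).

(** By the wrap-around, $q$ divides the unit $c_0 = q c_d$. *)
Lemma ratio_unit : ratio d k \is a GRing.unit.
Proof.
have := weight0_unit d_gt0 k_gt0.
have -> : (weight d k 0)%:R = ratio d k * (weight d k (ord_max : 'I_n))%:R :> 'Z_N.
  by rewrite -ratio_weight //= modnn.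
by rewrite unitrM => /andP[].
Qed.

Lemma generators_automorphism :
  Ttrans R kk `|` Rrefl R kk `|` Ccyc R kk `<=` automorphism R kk.
Proof.
move=> f [[[v [a ->]]|]|[m]].
- move=> /(induced_vertex_map _ (lattice_symmetryD a)).
  by apply: (symmetry_automorphism (lattice_symmetryD a)); apply: addIr.
- move=> /(induced_vertex_map _ lattice_symmetryN).
  by apply: (symmetry_automorphism lattice_symmetryN); apply: oppr_inj.
move=> /(induced_vertex_map _ (lattice_symmetry_shift m)).
apply: (symmetry_automorphism (lattice_symmetry_shift m)).
by apply: mulrI; rewrite unitrX // ratio_unit.
Qed.

Lemma automorphism_subgroup : subgroup (automorphism R kk).
Proof.
split.
- by split; [exists id|].
- move=> f g [fb hf] [gb hg]; split; first exact: bij_comp.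
  by move=> c c'; rewrite /= hf hg.
move=> f g [_ hf] fK gK; split; first by exists f.
by move=> c c'; rewrite -hf !gK.
Qed.

Lemma generated_subgroup (X : Type) (G : set (X -> X)) : subgroup (generated G).
Proof.
split.
- by move=> H [[]].
- by move=> f g hf hg H [Hsub GH]; have [_ + _] := Hsub; apply; [apply: hf|apply: hg].
- by move=> f g hf fK gK H [Hsub GH]; have [_ _ /(_ f g)] := Hsub; apply=> //; apply: hf.
Qed.

(** The map $x \mapsto z \pm q^m x$ is the $m$-fold shift, followed by the reflection if the sign is
    negative, then by a translation. *)
Lemma automorphism_generated :
  automorphism R kk = generated (Ttrans R kk `|` Rrefl R kk `|` Ccyc R kk).
Proof.
apply/seteqP; split; last first.
  exact: smallest_sub automorphism_subgroup generators_automorphism.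
set G := generated _; have [_ Gcomp _] : subgroup G by apply: generated_subgroup.
have GS : Ttrans R kk `|` Rrefl R kk `|` Ccyc R kk `<=` G by exact: sub_gen_smallest.
move=> f /automorphism_affine[e [m [z hf]]].
have [b zb] := phi_surj d_gt0 k_gt0 z; subst z.
have [t ht] := symmetry_exists (lattice_symmetryD b).
have [r hr] := symmetry_exists lattice_symmetryN.
have [s hs] := symmetry_exists (lattice_symmetry_shift m).
have Gt : G t.
  apply: GS; left; left; exists (pt b); first by exists b.
  by apply/(induced_vertex_map t (lattice_symmetryD b)).
have Gr : G r by apply: GS; left; right; apply/(induced_vertex_map r lattice_symmetryN).
have Gs : G s.
  by apply: GS; right; exists m; apply/(induced_vertex_map s (lattice_symmetry_shift m)).
case: e hf => hf.
  have -> : f = t \o (r \o s).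
    apply: (vertex_map_unique hf).
    have := vertex_map_comp ht (vertex_map_comp hr hs); congr vertex_map.
    by apply/funext => x /=; rewrite expr1 mulN1r addrC.
  exact: (Gcomp _ _ Gt (Gcomp _ _ Gr Gs)).
have -> : f = t \o s.
  apply: (vertex_map_unique hf).
  have := vertex_map_comp ht hs; congr vertex_map.
  by apply/funext => x /=; rewrite expr0 mul1r addrC.
exact: (Gcomp _ _ Gt Gs).
Qed.

Let n_ge3 : (2 < n)%N. Proof. exact: d_ge2. Qed.

(** The value at 0 gives the translation part; the value at $w_0$ then gives $\pm w_m$, hence the
    sign and $m$. *)
Lemma affine_map_inj : injective affine_map.
Proof.
move=> [[z e] m] [[z' e'] m'] /funeqP h.
have := h 0; rewrite /affine_map /= !mulr0 !addr0 => zz; subst z'.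
have := h (weight d k 0)%:R; rewrite /affine_map /= => /addrI.
rewrite -!weight_ratioX // -!omega1 => em.
have [-> emm] : e' = e /\ om [set m]%SET = om [set m']%SET.
  case: e e' em {h} => -[]; rewrite ?expr0 ?expr1 ?mul1r ?mulN1r //.
  - by move/oppr_inj.
  - by move/esym/(omega_set1_neq d_ge2 k_gt0).
  - by move/(omega_set1_neq d_ge2 k_gt0).
by rewrite (set1_inj (omega_inj d_gt0 k_gt0 (set1_neqT n_ge3 m) (set1_neqT n_ge3 m') emm)).
Qed.

Lemma affine_map_automorphism t : exists2 f, automorphism R kk f & vertex_map f (affine_map t).
Proof.
case: t => -[z e] m.
have [b zb] := phi_surj d_gt0 k_gt0 z; subst z.
pose g (x : V) := (if e then -%R else id) (iter m (@cyclic_shift R d) x) + pt b.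
have sym : lattice_symmetry g (affine_map (ph b, e, m)).
  have -> : affine_map (ph b, e, m) = (fun z : 'Z_N => z + ph b) \o
      ((if e then -%R else id) \o (fun z => ratio d k ^+ m * z)).
    apply/funext => z; rewrite /affine_map /= addrC.
    by case: e {g}; rewrite ?expr1 ?expr0 ?mulN1r ?mul1r.
  apply: (lattice_symmetry_comp (lattice_symmetryD b)).
  apply: (@lattice_symmetry_comp (if e then -%R else id)); last exact: lattice_symmetry_shift.
  by case: e {g}; [apply: lattice_symmetryN|apply: lattice_symmetry_id].
have [f hf] := symmetry_exists sym; exists f => //.
apply: (symmetry_automorphism sym) => // x y.
rewrite /affine_map /= => /addrI /(mulrI (unitrX _ (unitrN1 _))).
by apply: mulrI; rewrite unitrX // ratio_unit.
Qed.

Lemma card_automorphism : automorphism R kk #= `I_(N * 2 * n).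
Proof.
have [Phi hPhi] := choice (fun t => let: ex_intro2 f fa hf := affine_map_automorphism t in
   ex_intro (fun f => automorphism R kk f /\ vertex_map f (affine_map t)) f (conj fa hf)).
have PhiI : injective Phi.
  move=> t u e; apply: affine_map_inj.
  have [_ ht] := hPhi t; have [_ hu] := hPhi u; rewrite e in ht.
  exact: vertex_map_fun_unique ht hu.
have -> : automorphism R kk = Phi @` [set: 'Z_N * bool * 'I_n].
  apply/seteqP; split=> [f /automorphism_affine[e [m [z hf]]]|_ [t _ <-]]; last first.
    by have [] := hPhi t.
  exists (z, e, m) => //; have [_ h] := hPhi (z, e, m).
  exact: vertex_map_unique h hf.
apply: (card_eq_trans (inj_card_eq (in2W PhiI))).
(* ['Z_N] has exactly $N$ elements because $N > 1$. *)
have card3 : #|{: 'Z_N * bool * 'I_n}| = (N * 2 * n)%N.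
  by rewrite !card_prod card_bool !card_ord Zp_cast ?modulus_gt1.
pose rk (t : 'Z_N * bool * 'I_n) : nat := enum_rank t.
have rkI : injective rk by move=> t u /val_inj/enum_rank_inj.
apply: (card_eq_trans (B := rk @` setT)).
  by rewrite card_eq_sym; apply: inj_card_eq; apply: in2W.
suff -> : rk @` setT = `I_(N * 2 * n) by exact: card_eqxx.
apply/seteqP; split=> [_ [t _ <-]|i] /=; first by rewrite -card3 ltn_ord.
rewrite -card3 => hi; exists (enum_val (Ordinal hi)) => //.
by rewrite /rk enum_valK.
Qed.
End QuotientComplex.

Theorem theorem6p1 (R : realType) (d k : nat) (hd : (2 <= d)%N)
  (hk : (1 <= k)%N) :
  let kk : 'I_d.+1 -> nat := fun _ => k in
  automorphism R kk = generated (Ttrans R kk `|` Rrefl R kk `|` Ccyc R kk) /\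
  exists2 n : nat,
    n%:Z = (2 * d.+1)%N%:Z * \det (Mmx kk) & automorphism R kk #= `I_n.
Proof.
move=> kk; split; first exact: automorphism_generated.
exists (modulus d k * 2 * d.+1)%N; last exact: card_automorphism.
rewrite /kk det_Mmx; last exact: ltnW.
by rewrite -PoszM -mulnA mulnC.
Qed.
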